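(* If $R$ is an integral domain and $S$ is a Specker $R$-algebra, then the space $S_*=\mathrm{Hom}_R(S,R)$ is homeomorphic to the space $\mathrm{Min}(S)$ of minimal prime ideals of $S$.
   Context: All algebras are commutative and unital and all algebra homomorphisms are unital. For a commutative $R$-algebra $S$, $\mathrm{Id}(S)$ is the set of idempotents of $S$, a Boolean algebra under $e\vee f=e+f-ef$, $e\wedge f=ef$, $\lnot e=1-e$. A nonzero idempotent $e\in S$ is faithful if for each $a\in R$, $ae=0$ implies $a=0$. A faithful generating algebra of idempotents of $S$ is a Boolean subalgebra $B$ of $\mathrm{Id}(S)$ that generates $S$ as an $R$-algebra and all of whose nonzero elements are faithful. $S$ is a Specker $R$-algebra if it is a commutative $R$-algebra that has a faithful generating algebra of idempotents. $S_*=\mathrm{Hom}_R(S,R)$ is the set of $R$-algebra homomorphisms $S\to R$ with the topology having subbasis $\{U_s:s\in S\}$, where $U_s=\{\alpha\in\mathrm{Hom}_R(S,R):\alpha(s)=0\}$ (for $R$ a domain this space is homeomorphic to the Stone space of $\mathrm{Id}(S)$). $\mathrm{Min}(S)$ is the set of minimal prime ideals of $S$ with the subspace topology inherited from the Zariski topology on the prime spectrum of $S$; its closed sets are the sets $Z(I)=\{P\in\mathrm{Min}(S): I\subseteq P\}$ for ideals $I$ of $S$. *)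

(* Defs.v *)
From HB Require Import structures.
From mathcomp Require Import all_boot all_order all_algebra.
From mathcomp Require Import all_classical topology.

Set Implicit Arguments.
Unset Strict Implicit.
Unset Printing Implicit Defensive.

Import GRing.Theory.

Local Open Scope classical_set_scope.
Local Open Scope ring_scope.

(* A commutative unital R-algebra is a commutative ring S with a unital ring
   morphism iota : R -> S, the scalar action being a . s = iota a * s.
   MathComp's comAlgType R (for which iota is in_alg S) requires 1 != 0 and so
   leaves out the zero algebra, which is a Specker algebra. *)
Section Specker.
Variables (R S : comPzRingType) (iota : {rmorphism R -> S}).

Definition idempotents : set S := [set e | e * e = e].

Definition id_join (e f : S) : S := e + f - e * f.
Definition id_meet (e f : S) : S := e * f.
Definition id_compl (e : S) : S := 1 - e.

Definition boolean_subalgebra (B : set S) : Prop :=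
  [/\ B `<=` idempotents, B 0 /\ B 1,
      forall e f, B e -> B f -> B (id_join e f),
      forall e f, B e -> B f -> B (id_meet e f)
    & forall e, B e -> B (id_compl e)].

Definition faithful (e : S) : Prop :=
  [/\ idempotents e, e != 0 & forall a : R, iota a * e = 0 -> a = 0].

Definition subalgebra (A : set S) : Prop :=
  [/\ A 1, forall (a : R) u v, A u -> A v -> A (iota a * u + v)
    & forall u v, A u -> A v -> A (u * v)].

Definition faithful_generating_algebra (B : set S) : Prop :=
  [/\ boolean_subalgebra B, smallest subalgebra B = setT
    & forall e, B e -> e != 0 -> faithful e].

Definition specker : Prop := exists B, faithful_generating_algebra B.

End Specker.

Section AlgebraDual.
Variables (R S : comPzRingType) (iota : {rmorphism R -> S}).

Record algebra_dual := AlgebraDual {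
  dual_rmorphism :> {rmorphism S -> R};
  dual_scalable : forall (a : R) (s : S),
    dual_rmorphism (iota a * s) = a * dual_rmorphism s
}.

HB.instance Definition _ := gen_eqMixin algebra_dual.
HB.instance Definition _ := gen_choiceMixin algebra_dual.

Definition dual_zero (s : S) : set algebra_dual :=
  [set alpha : algebra_dual | alpha s = 0].

HB.instance Definition _ :=
  isSubBaseTopological.Build algebra_dual (range dual_zero) id.

End AlgebraDual.

Section Ideals.
Variable A : comPzRingType.

Definition ideal (I : set A) : Prop :=
  [/\ I 0, forall u v, I u -> I v -> I (u + v)
    & forall a u, I u -> I (a * u)].

Definition prime_ideal (P : set A) : Prop :=
  [/\ ideal P, ~ P 1 & forall u v, P (u * v) -> P u \/ P v].

Record Spec := MkSpec {
  ideal_of_Spec :> set A;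
  Spec_prime : prime_ideal ideal_of_Spec
}.

HB.instance Definition _ := gen_eqMixin Spec.
HB.instance Definition _ := gen_choiceMixin Spec.

Definition zero_locus (I : set A) : set Spec := [set P : Spec | I `<=` P].

Definition zariski_open : set (set Spec) :=
  [set ~` zero_locus I | I in ideal].

Lemma zariski_openT : zariski_open setT.
Proof.
exists setT; first by split.
by apply/seteqP; split=> // P _ /(_ 1 I); case: (Spec_prime P).
Qed.

Lemma zariski_openI : setI_closed zariski_open.
Proof.
move=> _ _ [I [I0 ID IM] <-] [J [J0 JD JM] <-]; exists (I `&` J).
  split=> [//|u v [Iu Ju] [Iv Jv]|a u [Iu Ju]].
    by split; [exact: ID|exact: JD].
  by split; [exact: IM|exact: JM].
rewrite -setCU; congr (~` _); apply/seteqP; split=> P /=; last first.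
  by case=> sP u [Iu Ju]; exact: sP.
move=> sP; have [IP|nIP] := pselect (I `<=` P); first by left.
right=> v Jv; apply: contrapT => nPv; apply: nIP => u Iu.
have [_ _ Pprime] := Spec_prime P.
have /Pprime[//|//] : (P : set A) (u * v).
by apply: sP; split; [rewrite mulrC; exact: IM|exact: JM].
Qed.

Lemma zariski_open_bigU (I : Type) (f : I -> set Spec) :
  (forall i, zariski_open (f i)) -> zariski_open (\bigcup_i f i).
Proof.
move=> /(_ _)/cid2 => fop; pose J i := s2val (fop i).
exists (smallest ideal (\bigcup_i J i)).
  split=> [K [[]]//|u v Iu Iv K KJ|a u Iu K KJ].
    by case: (KJ) => -[_ KD _] _; apply: KD; [exact: Iu|exact: Iv].
  by case: (KJ) => -[_ _ KM] _; apply: KM; exact: Iu.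
apply/seteqP; split=> P.
  move=> nP; apply: contrapT => nfP; apply: nP.
  apply: smallest_sub; first by case: (Spec_prime P).
  move=> u [i _ Ju]; apply: contrapT => nPu; apply: nfP; exists i => //.
  by rewrite -(s2valP' (fop i)) => /(_ u Ju).
move=> [i _]; rewrite -(s2valP' (fop i)) => nP sP; apply: nP => u Ju.
by apply: sP; apply: sub_gen_smallest; exists i.
Qed.

HB.instance Definition _ := isOpenTopological.Build Spec
  zariski_openT zariski_openI zariski_open_bigU.

Definition minimal_primes : set Spec :=
  [set P : Spec | forall Q : Spec, Q `<=` P -> Q = P :> set A].

(* A set coerced to a type carries the library's subspace topology. *)
Definition Min : topologicalType := set_type minimal_primes.

End Ideals.

Definition homeomorphic (X Y : topologicalType) : Prop :=
  exists (f : X -> Y) (g : Y -> X),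
    [/\ cancel f g, cancel g f, continuous f & continuous g].

(* Main.v *)
Require Import Defs.
From HB Require Import structures.
From mathcomp Require Import all_boot all_order all_algebra.
From mathcomp Require Import finmap.
From mathcomp Require Import all_classical topology.
From mathcomp Require Import ring.

(* The homeomorphism sends alpha to its kernel.  Let B be a faithful generating
   algebra of idempotents and P a prime of S.  Then Q = {s | s e = 0 for some
   e in B outside P} is an ideal contained in P.  Those s that are congruent
   modulo Q to some iota a form a subalgebra containing B, so all of S, and a
   is unique because the nonzero elements of B are faithful.  Hence s |-> a is
   a homomorphism S -> R with kernel Q, and Q is prime as R is a domain.
   A minimal P is therefore equal to Q, and a prime P contained in ker alpha
   gives Q = ker alpha because both homomorphisms agree on every iota a. *)

Set Implicit Arguments.
Unset Strict Implicit.
Unset Printing Implicit Defensive.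

Import GRing.Theory.

Local Open Scope classical_set_scope.
Local Open Scope ring_scope.

(** * Topology of the space of algebra homomorphisms *)

Section AlgebraDualTopology.
Variables (R S : comPzRingType) (iota : {rmorphism R -> S}).
Implicit Types (alpha beta : algebra_dual iota) (s : S).

Lemma algebra_dual_iota alpha a : alpha (iota a) = a.
Proof. by rewrite -[iota a]mulr1 dual_scalable rmorph1 mulr1. Qed.

Lemma algebra_dual_ext alpha beta : alpha =1 beta -> alpha = beta.
Proof.
case: alpha beta => [f fZ] [g gZ] /= efg.
have {}efg : f = g.
  case: f g {fZ gZ} efg => f cf [g cg] /= /funext efg.
  rewrite {}efg in cf *; congr GRing.RMorphism.Pack.
  case: cf cg => [[fD] [fM]] [[gD] [gM]].
  by rewrite (Prop_irrelevance fD gD) (Prop_irrelevance fM gM).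
by subst g; rewrite (Prop_irrelevance fZ gZ).
Qed.

Lemma open_dual_zero s : open (@dual_zero _ _ iota s).
Proof.
exists [set @dual_zero _ _ iota s]; last by rewrite bigcup_set1.
move=> _ ->; exists [fset (@dual_zero _ _ iota s)]%fset.
  by move=> _ /fset1P ->; rewrite inE; exists s.
by rewrite set_fset1 bigcap_set1.
Qed.

Lemma continuous_to_dual (X : topologicalType) (g : X -> algebra_dual iota) :
  (forall s, open (g @^-1` @dual_zero _ _ iota s)) -> continuous g.
Proof.
move=> og; apply/continuousP => _ [D DI <-]; rewrite preimage_bigcup.
apply: bigcup_open => _ /DI[F FD <-]; rewrite preimage_bigcap.
(* [big_seq] keeps the membership in [F], which makes each factor subbasic. *)
rewrite bigcap_fset big_seq; elim/big_ind: _ => [|*|U /FD].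
- exact: openT.
- exact: openI.
- by rewrite inE => -[s _ <-]; exact: og.
Qed.

(* [alpha s <> 0] is the union over [a <> 0] of the conditions
   [alpha (s - iota a) = 0]. *)
Lemma open_dual_neq0 s : open [set alpha : algebra_dual iota | alpha s <> 0].
Proof.
have -> : [set alpha : algebra_dual iota | alpha s <> 0] =
    \bigcup_(a in [set a | a <> 0]) @dual_zero _ _ iota (s - iota a).
  rewrite predeqE => alpha; split=> [nz|[a nz]].
    exists (alpha s) => //=.
    by rewrite /dual_zero /= rmorphB algebra_dual_iota subrr.
  rewrite /dual_zero /= rmorphB algebra_dual_iota => /eqP.
  by rewrite subr_eq0 => /eqP ->.
by apply: bigcup_open => a _; exact: open_dual_zero.
Qed.

End AlgebraDualTopology.

(** * Kernels as prime ideals *)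

Section Kernel.
Variables (R : idomainType) (S : comPzRingType) (iota : {rmorphism R -> S}).

Definition kernel (alpha : algebra_dual iota) : set S := [set s | alpha s = 0].

Lemma kernel_prime (alpha : algebra_dual iota) : prime_ideal (kernel alpha).
Proof.
rewrite /kernel; split=> [|/=|u v /=].
- split=> [/=|u v /= u0 v0|a u /= u0].
  + exact: rmorph0.
  + by rewrite rmorphD u0 v0 addr0.
  + by rewrite rmorphM u0 mulr0.
- by rewrite rmorph1; apply/eqP; exact: oner_neq0.
- by rewrite rmorphM => /eqP; rewrite mulf_eq0 => /orP[/eqP|/eqP]; [left|right].
Qed.

Definition kernel_Spec alpha : Spec S := MkSpec (kernel_prime alpha).

(** The kernel determines the values: [s - iota (alpha s)] always lies in it. *)
Lemma kernel_inj alpha beta : kernel alpha = kernel beta -> alpha = beta.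
Proof.
move=> eker; apply: algebra_dual_ext => s.
have : kernel beta (s - iota (alpha s)).
  by rewrite -eker /kernel /= rmorphB algebra_dual_iota subrr.
rewrite /kernel /= rmorphB algebra_dual_iota => /eqP.
by rewrite subr_eq0 => /eqP.
Qed.

End Kernel.

(** * Basic open sets of the spectrum *)

Section PrimeIdeals.
Variable A : comPzRingType.

Lemma Spec_ext (P Q : Spec A) : P = Q :> set A -> P = Q.
Proof.
case: P Q => [P pP] [Q pQ] /= ePQ; subst Q.
by rewrite (Prop_irrelevance pP pQ).
Qed.

Lemma principal_ideal (e : A) : ideal (range ( *%R e)).
Proof.
split=> [|_ _ [u _ <-] [v _ <-]|a _ [u _ <-]].
- by exists 0; rewrite ?mulr0.
- by exists (u + v); rewrite ?mulrDr.
- by exists (a * u); rewrite // mulrCA.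
Qed.

Lemma open_notin_Spec (e : A) : open [set P : Spec A | ~ (P : set A) e].
Proof.
exists (range ( *%R e)); first exact: principal_ideal.
rewrite predeqE => P; have [[_ _ PM] _ _] := Spec_prime P.
split=> /= nP.
  by move=> Pe; apply: nP => _ [u _ <-]; rewrite mulrC; exact: PM.
by move=> /(_ e) eP; apply: nP; apply: eP; exists 1; rewrite ?mulr1.
Qed.

End PrimeIdeals.

(** * Local kernels and minimal primes *)

Section Localization.
Variables (R : idomainType) (S : comPzRingType) (iota : {rmorphism R -> S}).
Variable B : set S.
Hypothesis genB : faithful_generating_algebra iota B.

(* The kernel of the localization of [S] at the ultrafilter [B `\` P]. *)
Definition local_kernel (P : Spec S) : set S :=
  [set s | exists e, [/\ B e, ~ (P : set S) e & s * e = 0]].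

Lemma local_kernel_sub P : local_kernel P `<=` P.
Proof.
move=> s [e [_ nPe se0]]; have [[P0 _ _] _ Pprime] := Spec_prime P.
by have [] := Pprime s e; rewrite ?se0.
Qed.

Lemma local_kernel_ideal P : ideal (local_kernel P).
Proof.
have [[_ [_ B1] _ BM _] _ _] := genB.
have [_ P1 Pprime] := Spec_prime P.
split=> [|u v [e [Be Pe ue]] [f [Bf Pf vf]]|a u [e [Be Pe ue]]].
- by exists 1; rewrite mul0r.
(* The product of the two witnesses kills both [u] and [v], and primality keeps it outside [P]. *)
- exists (e * f); split; first exact: BM.
    by move/Pprime => [].
  by rewrite mulrDl mulrA ue mul0r add0r mulrCA vf mulr0.
- by exists e; split; rewrite // -mulrA ue mulr0.
Qed.

(** A witness outside [P] is nonzero, hence faithful. *)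
Lemma local_kernel_iota P a : local_kernel P (iota a) -> a = 0.
Proof.
have [_ _ faithB] := genB.
move=> [e [Be Pe]]; have [[P0 _ _] _ _] := Spec_prime P.
have /faithB[//|_ _] : e != 0 by apply/eqP => e0; rewrite e0 in Pe.
exact.
Qed.

Lemma germ_exists P s : exists a, local_kernel P (s - iota a).
Proof.
have [[Bid [_ B1] _ BM BC] gen _] := genB.
have [_ P1 Pprime] := Spec_prime P.
have [Q0 QD QM] := local_kernel_ideal P.
suff : smallest (subalgebra iota) B `<=`
    [set s | exists a, local_kernel P (s - iota a)] by rewrite gen; exact.
apply: smallest_sub => [|e Be].
  split=> [|a u v [b ub] [c vc]|u v [b ub] [c vc]] /=.
  - by exists 1; rewrite rmorph1 subrr.
  - exists (a * b + c); rewrite rmorphD rmorphM.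
    have -> : iota a * u + v - (iota a * iota b + iota c) =
      iota a * (u - iota b) + (v - iota c) by ring.
    exact/QD/vc/QM.
  - exists (b * c); rewrite rmorphM.
    have -> : u * v - iota b * iota c =
      v * (u - iota b) + iota b * (v - iota c) by ring.
    by apply: QD; exact: QM.
(* Outside [P], [e] itself kills [e - 1], so its germ is 1. Inside [P], the complement [1 - e] is
   outside [P] and kills [e], so its germ is 0. *)
have [Pe|Pe] := pselect ((P : set S) e); last first.
  by exists 1; exists e; split; rewrite // rmorph1 mulrBl mul1r Bid // subrr.
exists 0; exists (1 - e); split; first exact: BC.
  have [[_ PD _] _ _] := Spec_prime P.
  by move=> Pe'; apply: P1; rewrite -(subrK e 1); exact: PD.
by rewrite rmorph0 subr0 mulrBr mulr1 Bid // subrr.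
Qed.

Lemma germ_unique P s a b :
  local_kernel P (s - iota a) -> local_kernel P (s - iota b) -> a = b.
Proof.
have [Q0 QD QM] := local_kernel_ideal P.
move=> sa sb; apply/eqP; rewrite -subr_eq0; apply/eqP.
apply: (@local_kernel_iota P); rewrite rmorphB.
have -> : iota a - iota b = (s - iota b) + (-1) * (s - iota a) by ring.
exact/QD/QM.
Qed.

Lemma local_kernelE P :
  exists alpha : algebra_dual iota, kernel alpha = local_kernel P.
Proof.
have [Q0 QD QM] := local_kernel_ideal P.
have /choice[f fP] := germ_exists P.
(* By uniqueness of germs, each morphism law for [f] reduces to a congruence modulo the local
   kernel. *)
have fE s a : local_kernel P (s - iota a) -> f s = a by exact: germ_unique.
have fB : zmod_morphism f.
  move=> u v; apply: fE; rewrite rmorphB.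
  have -> : u - v - (iota (f u) - iota (f v)) =
    (u - iota (f u)) + (-1) * (v - iota (f v)) by ring.
  exact/QD/QM.
have fM : monoid_morphism f.
  split=> [|u v]; apply: fE; first by rewrite rmorph1 subrr.
  rewrite rmorphM.
  have -> : u * v - iota (f u) * iota (f v) =
    v * (u - iota (f u)) + iota (f u) * (v - iota (f v)) by ring.
  by apply: QD; exact: QM.
pose faM := GRing.isZmodMorphism.Build S R f fB.
pose fmM := GRing.isMonoidMorphism.Build S R f fM.
pose fR : {rmorphism S -> R} := HB.pack f faM fmM.
have fZ a s : fR (iota a * s) = a * fR s.
  apply: fE; rewrite rmorphM -mulrBr; exact: QM.
exists (AlgebraDual fZ); rewrite /kernel predeqE => s /=; split=> [fs0|s0].
  by rewrite -[s]subr0 -(rmorph0 iota) -fs0.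
by apply: fE; rewrite rmorph0 subr0.
Qed.

Lemma local_kernel_max (alpha : algebra_dual iota) (P : Spec S) :
  P `<=` kernel alpha -> local_kernel P = kernel alpha.
Proof.
move=> Pa; have [beta eb] := local_kernelE P.
suff -> : alpha = beta by [].
apply: algebra_dual_ext => s.
have : local_kernel P (s - iota (beta s)).
  by rewrite -eb /kernel /= rmorphB algebra_dual_iota subrr.
move=> /local_kernel_sub/Pa; rewrite /kernel /= rmorphB algebra_dual_iota.
by move/eqP; rewrite subr_eq0 => /eqP.
Qed.

Lemma kernel_minimal (alpha : algebra_dual iota) :
  minimal_primes (kernel_Spec alpha).
Proof.
move=> Q Qa; apply/seteqP; split=> //.
by rewrite /= -(local_kernel_max Qa); exact: local_kernel_sub.
Qed.

(** The local kernel is the kernel of a homomorphism into a domain, hence a prime inside [P]. *)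
Lemma minimal_local_kernel (P : Spec S) :
  minimal_primes P -> local_kernel P = P.
Proof.
have [alpha ealpha] := local_kernelE P => minP.
rewrite -ealpha; apply: (minP (kernel_Spec alpha)).
by rewrite /= ealpha; exact: local_kernel_sub.
Qed.

Definition kernel_Min (alpha : algebra_dual iota) : Min S :=
  exist _ (kernel_Spec alpha) (mem_set (@kernel_minimal alpha)).

Lemma Min_kernel (P : Min S) : exists alpha, kernel_Min alpha = P.
Proof.
case: P => P minP; have [alpha ealpha] := local_kernelE P.
exists alpha; apply: val_inj => /=; apply: Spec_ext => /=.
by rewrite ealpha minimal_local_kernel //; exact: set_mem.
Qed.

Lemma kernel_Min_inj : injective kernel_Min.
Proof. by move=> alpha beta [] /kernel_inj. Qed.

Lemma kernel_Min_continuous : continuous kernel_Min.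
Proof.
apply/continuousP => _ [_ [I idI <-] <-].
(* The kernel of [alpha] fails to contain [I] exactly when [alpha] is nonzero at some element of
   [I]. *)
have -> : kernel_Min @^-1` (set_val @^-1` (~` zero_locus I)) =
    \bigcup_(s in I) [set alpha | alpha s <> 0].
  rewrite predeqE => alpha; split=> /=.
    move=> nI; apply: contrapT => nex; apply: nI => s Is /=.
    by apply: contrapT => nz; apply: nex; exists s.
  by move=> [s Is nz] sI; apply: nz; exact: (sI s Is).
by apply: bigcup_open => s _; exact: open_dual_neq0.
Qed.

(* In a minimal prime, membership of [s] is witnessed by some [e \notin P]
   with [s * e = 0], a condition that persists on the neighborhood
   [e \notin P'] of [P]. *)
Lemma open_mem_Min s : open [set P : Min S | (val P : set S) s].
Proof.
have -> : [set P : Min S | (val P : set S) s] =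
    \bigcup_(e in [set e | s * e = 0])
      (set_val @^-1` [set P : Spec S | ~ (P : set S) e] : set (Min S)).
  rewrite predeqE => P; split=> /= [Ps|[e /= se0 Pe]].
    have minP : minimal_primes (val P) by exact/set_mem/valP.
    have [e [_ Pe se0]] : local_kernel (val P) s.
      by rewrite minimal_local_kernel.
    by exists e.
  have [[P0 _ _] _ Pprime] := Spec_prime (val P).
  by have [] := Pprime s e; rewrite ?se0.
apply: bigcup_open => e _; exists [set P : Spec S | ~ (P : set S) e] => //.
exact: open_notin_Spec.
Qed.

End Localization.

Theorem theorem4p6 (R : idomainType) (S : comPzRingType)
    (iota : {rmorphism R -> S}) :
  specker iota -> homeomorphic (algebra_dual iota) (Min S).
Proof.
(* [g] is a chosen right inverse of [kernel_Min]; injectivity makes it two-sided. *)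
move=> [B genB]; have /choice[g gK] := Min_kernel genB.
exists (kernel_Min genB), g; split=> //.
- by move=> alpha; exact: (kernel_Min_inj (gK _)).
- exact: kernel_Min_continuous.
apply: continuous_to_dual => s.
(* Since [P] is the kernel of [g P], vanishing of [g P] at [s] means that [s] lies in [P]. *)
suff -> : g @^-1` @dual_zero _ _ iota s = [set P : Min S | (val P : set S) s].
  exact: open_mem_Min genB s.
by rewrite predeqE => P /=; rewrite -{2}(gK P).
Qed.
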